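(* Let $(\Omega,\mathcal{A},\mu)$ be a $\sigma$-finite measure space and let $p(\cdot):\Omega\to[1,\infty]$ be an exponent function with $\mu(\{p=\infty\})=0$. Then the set $\mathcal{C}_{p(\cdot)}$ of $p(\cdot)$-countable functions is dense in $L^{p(\cdot)}$.
   Context: Functions are real-valued, measurable, and identified when equal $\mu$-a.e. An exponent function is a measurable function $p(\cdot):\Omega\to[1,\infty]$. When $p<\infty$ a.e., the modular is $\rho_{p(\cdot)}(f)=\int_\Omega|f(x)|^{p(x)}\,d\mu(x)$; $L^{p(\cdot)}$ consists of all $f$ with $\rho_{p(\cdot)}(f/\lambda)<\infty$ for some $\lambda>0$, with norm $\|f\|_{p(\cdot)}=\inf\{\lambda>0:\rho_{p(\cdot)}(f/\lambda)\le1\}$. A measurable set $E\subseteq\Omega$ is $p(\cdot)$-bounded if $\operatorname{ess\,sup}_{x\in E}p(x)<\infty$. The set of $p(\cdot)$-countable functions is $$\mathcal{C}_{p(\cdot)}=\{f\in L^{p(\cdot)}: f\text{ restricted to any }p(\cdot)\text{-bounded subset of }\Omega\text{ is a simple function}\},$$ where a simple function is a measurable function taking finitely many values (up to null sets). *)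

(* Defs.v *)
From HB Require Import structures.
From mathcomp Require Import all_boot all_order all_algebra.
From mathcomp Require Import all_classical all_reals all_analysis.
From mathcomp Require Import measurable_realfun ess_sup_inf.

Set Implicit Arguments.
Unset Strict Implicit.
Unset Printing Implicit Defensive.

Import Order.TTheory GRing.Theory Num.Theory.
Import numFieldNormedType.Exports HBSimple.

Local Open Scope classical_set_scope.
Local Open Scope ring_scope.
Local Open Scope ereal_scope.

(* Elements of the function spaces are represented by measurable functions,
   without passing to the quotient by a.e. equality: every predicate below is
   invariant, among measurable functions, under a.e. equality. *)

Definition exponent_function d (T : measurableType d) (R : realType)
    (p : T -> \bar R) : Prop :=
  measurable_fun [set: T] p /\ (forall x, 1 <= p x).

Section variable_Lebesgue.
Context d (T : measurableType d) (R : realType).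
Variables (mu : {measure set T -> \bar R}) (p : T -> \bar R).

(* This is the modular of an exponent that is finite a.e.: [fine] sends +oo
   to 0, which only matters on the set where p = +oo. *)
Definition modular (f : T -> R) : \bar R :=
  \int[mu]_x (`|f x| `^ fine (p x))%:E.

Definition Lvar : set (T -> R) :=
  [set f : T -> R | measurable_fun [set: T] f /\
     exists2 l : R, (0 < l)%R & modular (fun x => f x / l)%R < +oo].

(* Extended-real valued, the infimum of the empty set being +oo. *)
Definition Lvar_norm (f : T -> R) : \bar R :=
  ereal_inf [set l%:E | l in
    [set l : R | (0 < l)%R /\ modular (fun x => f x / l)%R <= 1]].

Definition p_bounded (E : set T) : Prop :=
  exists mE : measurable E, ess_sup (mrestr mu mE) p < +oo.

Definition simple_on (E : set T) (f : T -> R) : Prop :=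
  exists g : {sfun T >-> R}, f = g %[ae mu in E].

Definition p_countable : set (T -> R) :=
  [set f | Lvar f /\ forall E, p_bounded E -> simple_on E f].

Definition Lvar_dense (S : set (T -> R)) : Prop :=
  S `<=` Lvar /\
  forall f, Lvar f -> forall e : R, (0 < e)%R ->
    exists2 g, S g & Lvar_norm (fun x => f x - g x)%R < e%:E.

End variable_Lebesgue.

(* Main.v *)
(** Cut the space into the slices [E n = {n <= p < n + 1}] (the null set
    [p = +oo] falls into [E 0], because [fine +oo = 0]).  Take simple functions
    [s k -> f] with [|s k|] and [|f - s k|] both dominated by [|f|].  As the
    exponent is bounded on [E n], finiteness of the modular of [f / l] for one
    [l] gives finiteness on [E n] for all [l], so by dominated convergence some
    [k n] makes the modular of [(f - s (k n)) / e] on [E n] at most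
    [2 ^- n.+1].  Glueing the [s (k n)] along the slices gives a function
    that is simple on every [p]-bounded set, and summing over the slices bounds
    the modular of its distance to [f], scaled by [e], by [1]. *)
Require Import Defs.
From HB Require Import structures.
From mathcomp Require Import all_boot all_order all_algebra.
From mathcomp Require Import all_classical all_reals all_analysis.
From mathcomp Require Import measurable_realfun ess_sup_inf.
From mathcomp Require Import ring.

Import Order.TTheory GRing.Theory Num.Theory.
Import numFieldNormedType.Exports HBSimple HBNNSimple.

Local Open Scope classical_set_scope.
Local Open Scope ring_scope.
Local Open Scope ereal_scope.

Lemma measurable_fun_powR2 {d} {T : measurableType d} {R : realType}
    {f g : T -> R} :
  measurable_fun [set: T] f -> measurable_fun [set: T] g ->
  measurable_fun [set: T] (fun x => f x `^ g x)%R.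
Proof.
move=> mf mg; rewrite /powR; apply: measurable_fun_ifT => //.
- exact: measurable_fun_eqr.
- rewrite (_ : (fun x => _) = (fun x => if g x == 0 then 1 else 0)%R).
    by apply: measurable_fun_ifT => //; exact: measurable_fun_eqr.
  by apply/funext => x; case: eqP.
- apply: measurableT_comp => //; apply: measurable_funM => //.
  exact: measurableT_comp.
Qed.

(** Once [|u n| < 1], an exponent at least 1 only shrinks it, so the powers are squeezed between 0
    and [|u n|]. *)
Lemma cvg_powR_norm0 {R : realType} {u : R^nat} {q : R} : (1 <= q)%R ->
  u n @[n --> \oo] --> 0%R -> (`|u n| `^ q)%R @[n --> \oo] --> 0%R.
Proof.
move=> q1 u0.
have nu0 : `|u n|%R @[n --> \oo] --> 0%R by rewrite -(normr0 R); exact: cvg_norm.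
apply: (squeeze_cvgr _ (cvg_cst 0%R) nu0).
have : \forall n \near \oo, (`|u n| < 1)%R by exact: (cvgr_lt _ nu0).
apply: filterS => n un1; rewrite powR_ge0/=.
have [->|un0] := eqVneq (u n) 0%R.
  by rewrite normr0 powR0// gt_eqF// (lt_le_trans ltr01).
by rewrite ge1r_powR// normr_gt0 un0 ltW.
Qed.

Lemma nnsfun_approximation {d} {T : measurableType d} {R : realType}
    {f : T -> R} :
  measurable_fun [set: T] f -> (forall x, 0 <= f x)%R ->
  exists s : {nnsfun T >-> R}^nat,
    (forall n x, s n x <= f x)%R /\ (forall x, s n x @[n --> \oo] --> f x).
Proof.
move=> mf f0; have mEf := (measurable_EFinP _ _).2 mf.
have Ef0 x : [set: T] x -> 0 <= (EFin \o f) x by rewrite lee_fin.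
have [s [nds cvs]] := approximation measurableT mEf Ef0.
have cs x : s n x @[n --> \oo] --> f x.
  by have /fine_cvgP[_] := cvs x I; apply: cvg_trans.
exists s; split => // n x.
(* A nondecreasing sequence stays below its limit. *)
have <- := cvg_lim (@Rhausdorff R) (cs x).
apply: nondecreasing_cvgn_le => [m k mk|]; first exact: (lefP _ _ (nds _ _ mk)).
by apply/cvg_ex; exists (f x); exact: cs.
Qed.

(** The positive and negative parts are approximated from below separately; both bounds then follow
    from [|f| = f^\+ + f^\-]. *)
Lemma sfun_approximation {d} {T : measurableType d} {R : realType}
    {f : T -> R} :
  measurable_fun [set: T] f ->
  exists s : {sfun T >-> R}^nat,
  [/\ forall n x, (`|s n x| <= `|f x|)%R,
      forall n x, (`|f x - s n x| <= `|f x|)%R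
    & forall x, s n x @[n --> \oo] --> f x].
Proof.
move=> mf.
have [a [af ca]] :=
  nnsfun_approximation (measurable_funrpos mf) (funrpos_ge0 f).
have [b [bf cb]] :=
  nnsfun_approximation (measurable_funrneg mf) (funrneg_ge0 f).
have fE x : (f x = f^\+ x - f^\- x)%R by rewrite -[in LHS](funrposBneg f).
have absfE x : (`|f x| = f^\+ x + f^\- x)%R.
  by have /(congr1 (@^~ x)) := funrposDneg f.
exists (fun n => (a n : {sfun T >-> R}) - (b n : {sfun T >-> R}))%R.
have sE n x : ((a n : {sfun T >-> R}) - (b n : {sfun T >-> R}))%R x =
  (a n x - b n x)%R by [].
split=> [n x|n x|x].
- rewrite sE absfE (le_trans (ler_normB _ _))// lerD//.
  + by rewrite ger0_norm.
  + by rewrite ger0_norm.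
- rewrite sE absfE fE opprB (addrC (b n x)) addrACA (addrC (- _) (b n x))%R.
  rewrite (le_trans (ler_normD _ _))// lerD//.
  + by rewrite ger0_norm ?subr_ge0// lerBlDr lerDl.
  + by rewrite distrC ger0_norm ?subr_ge0// lerBlDr lerDl.
- rewrite fE; exact: (cvgB (ca x) (cb x)).
Qed.

(** Dominated convergence: as [q <= M] on [D], passing from scale [l] to scale [e] costs at most a
    constant factor. *)
Lemma cvg_integral_powR_norm {d} {T : measurableType d} {R : realType}
    {mu : {measure set T -> \bar R}} {D : set T} {q f : T -> R}
    {s : (T -> R)^nat} {l e M : R} :
  measurable D -> measurable_fun [set: T] q -> measurable_fun [set: T] f ->
  (forall n, measurable_fun [set: T] (s n)) ->
  (forall x, 0 <= q x)%R -> {ae mu, forall x, (1 <= q x)%R} ->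
  (forall x, D x -> q x <= M)%R ->
  (forall n x, `|f x - s n x| <= `|f x|)%R ->
  (forall x, s n x @[n --> \oo] --> f x) ->
  (0 < l)%R -> (0 < e)%R ->
  \int[mu]_(x in D) (`|f x / l| `^ q x)%:E < +oo ->
  \int[mu]_(x in D) (`|(f x - s n x) / e| `^ q x)%:E @[n --> \oo] --> 0.
Proof.
move=> mD mq mf ms q0 q1 qM fs cs l0 e0 foo.
(* The maximum with 1 makes [K] to the power [q x] at most [K] to the power [M]. *)
pose K := Num.max 1%R (l / e)%R.
have le0 : (0 <= l / e)%R by rewrite divr_ge0// ltW.
have mpow (h : T -> R) : measurable_fun [set: T] h ->
    measurable_fun D (fun x => (`|h x| `^ q x)%:E).
  move=> mh; apply: measurable_funTS; apply/measurable_EFinP.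
  by apply: measurable_fun_powR2 => //; exact: measurableT_comp.
have mfl : measurable_fun [set: T] (fun x => f x / l)%R by exact: measurable_funM.
have ipow : mu.-integrable D (fun x => (K `^ M)%:E * (`|f x / l| `^ q x)%:E).
  apply: integrableZl => //; apply/integrableP; split; first exact: mpow.
  by under eq_integral do rewrite gee0_abs ?lee_fin ?powR_ge0//.
have dom n x : D x -> `|(`|(f x - s n x) / e| `^ q x)%:E| <=
    (K `^ M)%:E * (`|f x / l| `^ q x)%:E.
  move=> Dx; rewrite gee0_abs ?lee_fin ?powR_ge0//.
  have K1 : (1 <= K)%R by rewrite le_max lexx.
  have K0 : (0 <= K)%R by exact: le_trans K1.
  apply: (@le_trans _ _ ((K * `|f x / l|) `^ q x)%R); last first.
    by rewrite powRM// ler_wpM2r ?powR_ge0// ler_powR// qM.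
  apply: ge0_ler_powR; rewrite ?nnegrE// ?mulr_ge0//.
  apply: (@le_trans _ _ ((l / e) * `|f x / l|)%R); last first.
    by rewrite ler_wpM2r// le_max lexx orbT.
  have -> : ((l / e) * `|f x / l| = `|f x| / e)%R.
    rewrite normrM normfV (gtr0_norm l0); field.
    by rewrite !gt_eqF.
  by rewrite normrM normfV (gtr0_norm e0) ler_wpM2r// invr_ge0 ltW.
have [] := @dominated_convergence _ _ _ mu D mD
  (fun n x => (`|(f x - s n x) / e| `^ q x)%:E) (cst 0)
  (fun x => (K `^ M)%:E * (`|f x / l| `^ q x)%:E) _ _ _ ipow _ => //.
- by move=> n; apply: mpow; apply: measurable_funM => //; exact: measurable_funB.
(* Where [q x = 0] the integrand is constantly 1, so pointwise convergence is obtained only almost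
   everywhere. *)
- apply: filterS q1 => x q1 _; apply: cvg_EFin; first exact: nearW.
  apply: cvg_powR_norm0 => //; rewrite -[X in _ --> X](mul0r (e^-1)%R).
  apply: cvgM; last exact: cvg_cst.
  by rewrite -(subrr (f x)); apply: cvgB => //; exact: cvg_cst.
- by apply: nearW => x n; exact: dom.
- by rewrite integral0.
Qed.

Lemma measurable_truncn_fiber {d} {T : measurableType d} {R : realType}
    (q : T -> R) (n : nat) :
  measurable_fun [set: T] q -> (forall x, 0 <= q x)%R ->
  measurable ((fun x => Num.truncn (q x)) @^-1` [set n]).
Proof.
move=> mq q0; have -> : (fun x => Num.truncn (q x)) @^-1` [set n] =
    [set: T] `&` q @^-1` [set` `[n%:R, n.+1%:R[ ].
  rewrite setTI; apply/seteqP; split => x /=; rewrite in_itv/=.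
    by move=> <-; exact: truncn_itv.
  exact: truncn_def.
exact: mq.
Qed.

Lemma measurable_fun_glue {d} {T : measurableType d} {R : realType}
    {m : T -> nat} {t : (T -> R)^nat} :
  (forall n, measurable (m @^-1` [set n])) ->
  (forall n, measurable_fun [set: T] (t n)) ->
  measurable_fun [set: T] (fun x => t (m x) x).
Proof.
move=> mm mt; have -> : [set: T] = \bigcup_n (m @^-1` [set n]).
  by apply/seteqP; split => // x _; exists (m x).
apply/measurable_fun_bigcup => // n.
by apply: eq_measurable_fun (measurable_funTS (mt n)) => x /set_mem /= ->.
Qed.

(** Induction on [N]: adding [(t N - h)] times the indicator of the fiber over [N] corrects [h]
    there and nowhere else. Only finitely many pieces are glued, so the result stays simple. *)
Lemma sfun_glue {d} {T : measurableType d} {R : realType} {m : T -> nat}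
    (t : {sfun T >-> R}^nat) (N : nat) :
  (forall n, measurable (m @^-1` [set n])) ->
  exists h : {sfun T >-> R}, forall x, (m x < N)%N -> h x = t (m x) x.
Proof.
move=> mm; elim: N => [|N [h hE]]; first by exists (t 0%N).
pose c : {sfun T >-> R} := indic_sfun _ (mm N).
exists (h + (t N - h) * c)%R => x; rewrite ltnS leq_eqVlt => mxN.
have -> : ((h + (t N - h) * c)%R x =
  h x + (t N x - h x) * \1_(m @^-1` [set N]) x)%R by [].
rewrite indicE; have [mx|mx] := eqVneq (m x) N.
  by rewrite mem_set//= mulr1 addrC subrK mx.
rewrite memNset ?mulr0 ?addr0 ?hE//=; last exact/eqP.
by move: mxN; rewrite (negbTE mx).
Qed.

Lemma p_bounded_ae_le {d} {T : measurableType d} {R : realType}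
    {mu : {measure set T -> \bar R}} {p : T -> \bar R} {A : set T} :
  p_bounded mu p A ->
  exists N : nat, {ae mu, forall x, A x -> p x <= N%:R%:E}.
Proof.
move=> [mA pA].
have [N pN] : exists N : nat, ess_sup (mrestr mu mA) p <= N%:R%:E.
  move: pA; case: ess_sup => [r _|//|_]; last by exists 0%N; rewrite leNye.
  by exists (Num.truncn r).+1; rewrite lee_fin ltW//; exact: truncnS_gt.
have /ess_supP[B [mB B0 pB]] := pN.
(* [B] is null for the restricted measure, that is, [B] meets [A] in a [mu]-null set. *)
exists N, (B `&` A); split => //; first exact: measurableI.
by move=> x /= /not_implyP[Ax pNx]; split => //; exact: pB.
Qed.

Theorem proposition4p4 (d : measure_display) (T : measurableType d)
    (R : realType) (mu : {sigma_finite_measure set T -> \bar R})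
    (p : T -> \bar R) (hp : exponent_function p)
    (hinf : mu [set x | p x = +oo] = 0) :
  Lvar_dense mu p (p_countable mu p).
Proof.
split=> [f []//|f [mf [l l0 foo]] e e0]; have [mp p1] := hp.
pose q x := fine (p x).
have mq : measurable_fun [set: T] q by exact: measurableT_comp.
have q0 x : (0 <= q x)%R by rewrite fine_ge0// (le_trans _ (p1 x)).
have pfin : {ae mu, forall x, p x \is a fin_num}.
  exists [set x | p x = +oo]; split => //.
    by rewrite -[X in measurable X]setTI; exact: mp (emeasurable_set1 +oo).
  (* Since [p >= 1] excludes [-oo], the only non-finite value is [+oo]. *)
  move=> x /= pNfin; apply: contrapT => /eqP pxoo; apply: pNfin.
  by rewrite fin_numE pxoo andbT -ltNye (lt_le_trans _ (p1 x))// ltNyr.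
have q1 : {ae mu, forall x, (1 <= q x)%R}.
  by apply: filterS pfin => x px; rewrite -lee_fin fineK// p1.
pose m x := Num.truncn (q x).
pose E n := m @^-1` [set n].
have mE n : measurable (E n) by exact: measurable_truncn_fiber.
have qE n x : E n x -> (q x <= n.+1%:R)%R.
  by rewrite /E/= => <-; have /andP[_ /ltW] := truncn_itv (q0 x).
have mpow (h : T -> R) (c : R) : measurable_fun [set: T] h ->
    measurable_fun [set: T] (fun x => (`|h x / c| `^ q x)%:E).
  move=> mh; apply/measurable_EFinP; apply: measurable_fun_powR2 => //.
  by apply: measurableT_comp => //; exact: measurable_funM.
have [s [sf fs cs]] := sfun_approximation mf.
(* A modular at most 1 at some scale bounds the norm by that scale only weakly; half of [e] leaves
   room for the strict inequality. *)
have e2 : (0 < e / 2)%R by rewrite divr_gt0.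
have ms n : measurable_fun [set: T] (s n) by [].
have exk n : exists k,
    \int[mu]_(x in E n) (`|(f x - s k x) / (e / 2)| `^ q x)%:E
    <= (1 / (2 ^ n.+1)%:R)%:E.
  have fnoo : \int[mu]_(x in E n) (`|f x / l| `^ q x)%:E < +oo.
    by apply: le_lt_trans foo; apply: ge0_subset_integral => //; exact: mpow.
  have /fine_cvgP[fin cv] :=
    cvg_integral_powR_norm (mE n) mq mf ms q0 q1 (qE n) fs cs l0 e2 fnoo.
  have ep : (0 < 1 / (2 ^ n.+1)%:R :> R)%R.
    by rewrite divr_gt0// ltr0n expn_gt0.
  have [k [kfin klt]] := filter_ex (filterI fin (cvgr_lt _ cv _ ep)).
  by exists k; rewrite -(fineK kfin) lee_fin ltW.
have [k kP] := choice exk.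
pose g x := s (k (m x)) x.
have mg : measurable_fun [set: T] g.
  exact: (@measurable_fun_glue _ _ _ _ (fun n => s (k n) : T -> R)).
exists g.
  split; last first.
    move=> A /p_bounded_ae_le[N pN].
    (* Almost everywhere on [A], [p <= N], so the slice index is at most [N]: the slices 0 to [N]
       suffice. *)
    have [h hE] := sfun_glue (fun n => s (k n)) N.+1 mE.
    exists h; apply: filterS2 pfin pN => x px AN Ax; rewrite hE// /m.
    rewrite -(ltr_nat R) (le_lt_trans (_ : _ <= q x)%R)//.
      by have /andP[] := truncn_itv (q0 x).
    rewrite (@le_lt_trans _ _ N%:R)%R ?ltr_nat//.
    by rewrite -lee_fin fineK// AN.
  (* The scale [l] of [f] also serves [g], because [|g| <= |f|] pointwise. *)
  split => //; exists l => //.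
  apply: le_lt_trans foo; apply: ge0_le_integral => //.
  - exact: mpow.
  - exact: mpow.
  - move=> x _; rewrite lee_fin; apply: ge0_ler_powR; rewrite ?nnegrE//.
      exact: q0.
    by rewrite !normrM ler_wpM2r ?normr_ge0//; exact: sf.
apply: (@le_lt_trans _ _ (e / 2)%:E); last first.
  by rewrite lte_fin gtr_pMr// invf_lt1// ltr1n.
apply: ereal_inf_lbound; exists (e / 2)%R => //; split => //.
have TE : [set: T] = \bigcup_n E n.
  by apply/seteqP; split => // x _; exists (m x).
rewrite /modular TE ge0_integral_bigcup//.
(* The slice bounds form a geometric series of sum 1. *)
- apply: le_trans (epsilon_trick0 xpredT ler01).
  apply: lee_nneseries => n _; first by move=> _; exact: integral_ge0.
  apply: le_trans (kP n); rewrite le_eqVlt; apply/orP; left; apply/eqP.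
  by apply: eq_integral => x /set_mem En; rewrite /g; have -> : m x = n by [].
- by rewrite -TE; apply: mpow; exact: measurable_funB.
- apply/trivIsetP => i j _ _ ij; apply/seteqP; split => // x [/= mi mj].
  by move: ij; rewrite -mi -mj eqxx.
Qed.
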